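(* Let $\alpha$ and $\beta$ be nonzero ordinals. Then the following conditions are equivalent. (a) $X_U(\beta)$ is not $[\alpha,\alpha]$-compact. (b) There exists a function $f:\beta\to\alpha$ such that, for every $K\subseteq\alpha$ with order type $<\alpha$, the set $f^{-1}(K)$ has order type $<\beta$. (c) For every nonempty set $X$ and every nonempty family $\tau$ of subsets of $X$, if $\tau$ is closed under arbitrary unions and $(X,\tau)$ is $[\alpha,\alpha]$-compact, then $(X,\tau)$ is $[\beta,\beta]$-compact.
   Context: For a nonempty set $X$, a nonempty family $\tau$ of subsets of $X$ (not necessarily a topology) and nonzero ordinals $\alpha,\beta$, $(X,\tau)$ is $[\beta,\alpha]$-compact if, whenever $(O_\delta)_{\delta\in\alpha}$ is a sequence of members of $\tau$ (repetitions allowed) with $\bigcup_{\delta\in\alpha}O_\delta=X$, there is $H\subseteq\alpha$ of order type $<\beta$ (in the induced order) with $\bigcup_{\delta\in H}O_\delta=X$. For a nonzero ordinal $\beta$, let $S_\beta(\beta)$ be the set of all functions $f:\beta\to\{0,1\}$ whose support $\{\delta\in\beta\mid f(\delta)=1\}$ has order type $<\beta$. For $\varepsilon\in\beta$ let $Z(\varepsilon)=\{f\in S_\beta(\beta)\mid f(\varepsilon)=0\}$. Then $X_U(\beta)$ denotes the pair $(S_\beta(\beta),\tau_U)$, where $\tau_U=\{\bigcup_{\varepsilon\in H}Z(\varepsilon)\mid H\subseteq\beta\}$ is the smallest family containing all the $Z(\varepsilon)$ and closed under unions. *)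

(* Defs.v *)
From mathcomp Require Import all_boot all_order all_classical.

Set Implicit Arguments.
Unset Strict Implicit.
Unset Printing Implicit Defensive.

Local Open Scope classical_set_scope.

(* An ordinal alpha is represented by a well-ordered type, standing for the
   set of the elements of alpha; thus the elements b : B stand for the ordinals
   smaller than B, b itself being the initial segment of its predecessors. *)
Definition well_ordered d (A : orderType d) : Prop :=
  wochoice.well_order (<=%O : rel A).

(* H, with the order induced by A, is order-isomorphic to some ordinal b
   smaller than B. The values of g outside H are irrelevant. *)
Definition order_type_lt dA dB (A : orderType dA) (B : orderType dB)
    (H : set A) : Prop :=
  exists (b : B) (g : A -> B),
    set_bij H [set y | (y < b)%O] g /\ {in H &, {mono g : x y / (x <= y)%O}}.
Arguments order_type_lt {dA dB A} B H.

Definition ord_compact dB dA (B : orderType dB) (A : orderType dA)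
    (X : Type) (tau : set (set X)) : Prop :=
  forall O : A -> set X,
    (forall d, tau (O d)) ->
    \bigcup_d O d = [set: X] ->
    exists H : set A, order_type_lt B H /\ \bigcup_(d in H) O d = [set: X].
Arguments ord_compact {dB dA} B A {X} tau.

(* Subfamilies may be empty, so such a family contains the empty set. *)
Definition union_closed (X : Type) (tau : set (set X)) : Prop :=
  forall F : set (set X), F `<=` tau -> tau (\bigcup_(U in F) U).

Definition small_support d (B : orderType d) : set (B -> bool) :=
  [set f | order_type_lt B [set e | f e = true]].
Arguments small_support {d} B.

Definition zero_at d (B : orderType d) (e : B) : set (small_support B) :=
  [set f : small_support B | val f e = false].

Definition tauU d (B : orderType d) : set (set (small_support B)) :=
  [set U | exists H : set B, U = \bigcup_(e in H) zero_at e].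
Arguments tauU {d} B.

(* Main.v *)
Require Import Defs.
From mathcomp Require Import all_boot all_order all_classical.

Import Order.TTheory.

Local Open Scope classical_set_scope.

(** Everything reduces to one fact on well-orders ([order_type_ltP]): a set [W]
of ordinals has order type [< beta] exactly when no strictly increasing map
sends [beta] into [W]; call [W] small in that case. In particular small sets
are stable under subsets and, more generally, under strictly increasing
preimages, and [beta] itself is not small.

Given [f] as in (b) and a cover [(O_e)] indexed by [beta], group its members
along the fibers of [f]: closure under unions makes
[V_d := \bigcup_(f e = d) O_e] a cover indexed by [alpha]. A subcover [K] of
[V] with type [< alpha] pulls back to the subcover [f^-1(K)] of [O], which has
type [< beta]. This is (b) => (c).

A subfamily [(Z(e))_(e in H)] covers [S_beta(beta)] iff [H] has order type
[>= beta]: a function outside the union is one that is [1] on all of [H], and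
the indicator of [H] is the least of these. Hence [X_U(beta)] is not
[[beta,beta]]-compact, which gives (c) => (a).

For (a) => (b), let [\bigcup_(e in H_d) Z(e)], for [d] in [alpha], be a cover
with no subcover of type [< alpha]. By the same criterion, [\bigcup_d H_d] is
large, so [beta] embeds into it, while [\bigcup_(d in K) H_d] is small whenever
[K] has type [< alpha]. Sending an ordinal [e] to some [d] such that [H_d] contains the image
of [e] yields [f]. *)

(** * Well-orders and small sets *)

Lemma well_ordered_least {d} {A : orderType d} (P : set A) :
  well_ordered A -> P !=set0 ->
  exists2 z, P z & forall y, P y -> (z <= y)%O.
Proof.
move=> Awo [x Px].
have [|z [[Pz zP] _]] := Awo (fun y => `[< P y >]).
  by exists x; apply/asboolP.
by exists z => [|y Py]; [exact/asboolP | apply: zP; apply/asboolP].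
Qed.

Lemma well_ordered_wf {d} {A : orderType d} :
  well_ordered A -> well_founded (fun x y : A => (x < y)%O).
Proof.
move=> Awo x; apply: contrapT => nAx.
have [z nAz zmin] := well_ordered_least (fun y => ~ Acc _ y) Awo
  (ex_intro _ x nAx).
apply: nAz; constructor => y yz; apply: contrapT => /zmin.
by rewrite leNgt yz.
Qed.

(** A strictly increasing self-map of a well-order is inflationary: below the
least counterexample, the map would produce a smaller one. *)
Lemma homo_lt_inflationary {d} {A : orderType d} (h : A -> A) :
  well_ordered A -> {homo h : x y / (x < y)%O} -> forall x, (x <= h x)%O.
Proof.
move=> Awo h_lt x; elim/(well_founded_ind (well_ordered_wf Awo)): x => x IH.
by rewrite leNgt; apply/negP => hx; have := IH _ hx; rewrite leNgt h_lt.
Qed.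

Definition embeds_in {dA dB} {A : orderType dA} (B : orderType dB)
    (W : set A) : Prop :=
  exists h : B -> A, (forall b, W (h b)) /\ {homo h : x y / (x < y)%O}.

Section Comparison.
Context {dA dB} {A : orderType dA} {B : orderType dB}.
Hypotheses (A_wo : well_ordered A) (B_wo : well_ordered B).
Variables (b0 : B) (W : set A).

(** The least strict upper bound of the values already given to the elements
of [W] below [x]; [b0] when these values are unbounded. *)
Definition collapse : A -> B :=
  Fix (well_ordered_wf A_wo) (fun=> B)
    (fun x g => xget b0 [set b |
       (forall y (yx : (y < x)%O), W y -> (g y yx < b)%O) /\
       forall c, (forall y (yx : (y < x)%O), W y -> (g y yx < c)%O) ->
         (b <= c)%O]).

Definition collapse_bound (x : A) : set B :=
  [set b | forall y, (y < x)%O -> W y -> (collapse y < b)%O].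

Lemma collapseP x : collapse_bound x !=set0 ->
  collapse_bound x (collapse x) /\
  forall c, collapse_bound x c -> (collapse x <= c)%O.
Proof.
move=> /(well_ordered_least _ B_wo)[b xb bmin].
pose least := [set b | collapse_bound x b /\
  forall c, collapse_bound x c -> (b <= c)%O].
have -> : collapse x = xget b0 least.
  rewrite /collapse Fix_eq //= => {b xb bmin} y g g' gg'.
  by have -> : g = g' by apply: functional_extensionality_dep => z;
    apply: functional_extensionality_dep => zy; exact: gg'.
by apply: (@xgetPex _ b0 least); exists b.
Qed.

(** The collapse of the well-behaved part [D] of [W] is an initial segment of
[B]. Either it is all of [B], and [B] embeds in [W] by a choice of preimages,
or it stops at some [b], and then [D] is all of [W]. *)
Lemma order_type_lt_or_embeds_nonempty : order_type_lt B W \/ embeds_in B W.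
Proof.
pose D := [set x | W x /\ collapse_bound x !=set0].
have lt_collapse x y : D x -> D y -> (x < y)%O -> (collapse x < collapse y)%O.
  by move=> [Wx _] [_ /collapseP[yb _]] xy; exact: yb.
have [surj|nsurj] := pselect (forall b, exists2 x, D x & collapse x = b).
  right; pose h b := sval (cid2 (surj b)).
  have Dh b : D (h b) by rewrite /h; case: cid2.
  have hK b : collapse (h b) = b by rewrite /h; case: cid2.
  exists h; split=> [b|b c bc]; first by have [] := Dh b.
  rewrite ltNge le_eqVlt; apply/negP => /orP[/eqP hcb|/lt_collapse].
    by move: bc; rewrite -(hK b) -(hK c) hcb ltxx.
  by move=> /(_ (Dh c) (Dh b)); rewrite !hK ltNge (ltW bc).
left; move/existsNP in nsurj.
have [b bN bmin] := well_ordered_least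
  [set b | ~ exists2 x, D x & collapse x = b] B_wo
  nsurj.
have DltW x : W x -> D x /\ (collapse x < b)%O.
  elim/(well_founded_ind (well_ordered_wf A_wo)): x => x IH Wx.
  have xb : collapse_bound x b by move=> y yx Wy; have [] := IH y yx Wy.
  have Dx : D x by split=> //; exists b.
  split=> //; rewrite lt_neqAle (collapseP _ (ex_intro _ b xb)).2 // andbT.
  by apply/eqP => cxb; apply: bN; exists x.
have collapse_mono : {in W &, {mono collapse : x y / (x <= y)%O}}.
  apply: le_mono_in => x y /set_mem /DltW[Dx _] /set_mem /DltW[Dy _].
  exact: lt_collapse.
exists b, collapse; split=> //; split.
- by move=> x /DltW[].
- move=> x y /[dup] xW; rewrite inE => Wx /[dup] yW; rewrite inE => Wy e.
  by apply/le_anti; rewrite -!collapse_mono // e lexx.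
- move=> c /= cb; apply: contrapT => cN.
  have /bmin : ~ exists2 x, D x & collapse x = c.
    by move=> [x [Wx _] xc]; apply: cN; exists x.
  by rewrite leNgt cb.
Qed.

End Comparison.

Lemma order_type_lt_or_embeds {dA dB} {A : orderType dA} {B : orderType dB}
    (W : set A) :
  well_ordered A -> well_ordered B -> order_type_lt B W \/ embeds_in B W.
Proof.
move=> A_wo B_wo; have [[b0]|NB] := pselect (inhabited B).
  exact: order_type_lt_or_embeds_nonempty.
right; exists (fun b => False_rect A (NB (inhabits b))).
by split=> [b|b]; case: (NB (inhabits b)).
Qed.

(** The negative characterization of smallness: an order isomorphism of [W]
with a proper initial segment of [B], composed with an embedding of [B] in [W],
would be a strictly increasing map of [B] into itself bounded by an element of
[B]. *)
Lemma order_type_ltP {dA dB} {A : orderType dA} {B : orderType dB}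
    (W : set A) :
  well_ordered A -> well_ordered B -> order_type_lt B W <-> ~ embeds_in B W.
Proof.
move=> A_wo B_wo; split=> [[b [g [[gW _ _] g_mono]]] [h [Wh h_lt]]|].
  have gh_lt : {homo g \o h : x y / (x < y)%O}.
    move=> x y /h_lt; rewrite !ltNge; apply: contra.
    by rewrite /= g_mono ?inE.
  have := homo_lt_inflationary _ B_wo gh_lt b.
  by rewrite leNgt [X in ~~ X]gW.
by case: (order_type_lt_or_embeds W A_wo B_wo).
Qed.

Lemma order_type_lt_homo {dA dA' dB} {A : orderType dA} {A' : orderType dA'}
    {B : orderType dB} (W : set A) (W' : set A') (h : A' -> A) :
  well_ordered A -> well_ordered A' -> well_ordered B ->
  {homo h : x y / (x < y)%O} -> W' `<=` h @^-1` W ->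
  order_type_lt B W -> order_type_lt B W'.
Proof.
move=> A_wo A'_wo B_wo h_lt W'W; rewrite !order_type_ltP//.
apply: contra_not => -[k [W'k k_lt]]; exists (h \o k).
by split=> [b|x y xy]; [exact: W'W | exact/h_lt/k_lt].
Qed.

Lemma order_type_lt_sub {dA dB} {A : orderType dA} {B : orderType dB}
    (W W' : set A) :
  well_ordered A -> well_ordered B ->
  W' `<=` W -> order_type_lt B W -> order_type_lt B W'.
Proof. by move=> A_wo B_wo; exact: (order_type_lt_homo _ _ id). Qed.

Lemma order_type_lt_set0 {dA dB} {A : orderType dA} {B : orderType dB} :
  well_ordered A -> well_ordered B -> [set: B] !=set0 ->
  order_type_lt B (set0 : set A).
Proof. by move=> A_wo B_wo [b _]; rewrite order_type_ltP// => -[h [/(_ b)]]. Qed.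

(** * The space of functions with small support *)

(** The least function lying outside the [zero_at e], [e] in [H], is the
indicator of [H], which belongs to the space exactly when [H] is small. *)
Lemma zero_at_coverP {d} {B : orderType d} (H : set B) : well_ordered B ->
  \bigcup_(e in H) zero_at e = [set: small_support B] <->
  ~ order_type_lt B H.
Proof.
move=> B_wo; split=> [Hcov Hlt|HN].
  have Hs : small_support B (fun e => `[< H e >]).
    by apply: order_type_lt_sub Hlt => // e /= /asboolP.
  have : [set: small_support B] (SigSub (mem_set Hs)) by [].
  by rewrite -Hcov => -[e He /asboolP].
rewrite -subTset => f _; apply: contrapT => fN; apply: HN.
have /set_mem := valP f; apply: order_type_lt_sub => // e He /=.
by apply: contrapT => /negP/negbTE fe0; apply: fN; exists e.
Qed.

Lemma tauU_union_closed {d} (B : orderType d) : union_closed (tauU B).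
Proof.
move=> F FU; exists [set e | exists2 H : set B,
  F (\bigcup_(e in H) zero_at e) & H e].
apply/seteqP; split=> [f [U FUU]|f [e [H FH He] fe]].
  have [H UE] := FU _ FUU; rewrite UE in FUU * => -[e He fe].
  by exists e => //; exists H.
by exists (\bigcup_(e in H) zero_at e) => //; exists e.
Qed.

Lemma tauU_not_compact {d} (B : orderType d) :
  well_ordered B -> ~ ord_compact B B (tauU B).
Proof.
move=> B_wo /(_ (@zero_at d B)) [].
- by move=> e; exists [set e]; rewrite bigcup_set1.
- apply/zero_at_coverP => //; rewrite order_type_ltP//; apply.
  by exists (fun b => b); split.
- by move=> H [Hlt /zero_at_coverP]; apply.
Qed.

(** * Transfer of compactness along maps with small preimages *)

(** Grouping the members of a cover along the fibers of [f] re-indexes it by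
[alpha]; closure under unions keeps the groups in [tau]. *)
Lemma ord_compact_transfer {da db} {alpha : orderType da}
    {beta : orderType db} (f : beta -> alpha) {X : Type} (tau : set (set X)) :
  (forall K : set alpha,
    order_type_lt alpha K -> order_type_lt beta (f @^-1` K)) ->
  union_closed tau -> ord_compact alpha alpha tau -> ord_compact beta beta tau.
Proof.
move=> f_small tauU tau_cpt O tauO Ocov.
pose V d := \bigcup_(U in O @` (f @^-1` [set d])) U.
have [||K [Klt Kcov]] := tau_cpt V.
- by move=> d; apply: tauU => _ [e _ <-].
- rewrite -subTset -Ocov => x [e _ Oex].
  by exists (f e) => //; exists (O e) => //; exists e.
exists (f @^-1` K); split; first exact: f_small.
rewrite -subTset -Kcov => x [d Kd [_ [e /= fed <-] Oex]].
by exists e => //=; rewrite fed.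
Qed.

(** A cover by unions of sets [Z(e)] without small subcover amounts to a family
[(H d)] of sets of ordinals with a large union, all of whose small subfamilies
have a small union. The map chooses, in a copy of [beta] inside the large
union, an index [d] for each point. *)
Lemma small_preimages_of_not_compact {da db} {alpha : orderType da}
    {beta : orderType db} : well_ordered beta ->
  ~ ord_compact alpha alpha (tauU beta) ->
  exists f : beta -> alpha, forall K : set alpha,
    order_type_lt alpha K -> order_type_lt beta (f @^-1` K).
Proof.
move=> beta_wo /existsNP[O /not_implyP[tauO /not_implyP[Ocov Osub]]].
have {tauO} [H HE] := choice tauO.
have OE K :
    \bigcup_(d in K) O d = \bigcup_(e in \bigcup_(d in K) H d) zero_at e.
  apply/seteqP; split=> [x [d Kd]|x [e [d Kd Hde] xe]].
    by rewrite HE => -[e Hde xe]; exists e => //; exists d.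
  by exists d => //; rewrite HE; exists e.
have Hsmall K : order_type_lt alpha K ->
    order_type_lt beta (\bigcup_(d in K) H d).
  move=> Klt; apply: contrapT => /(zero_at_coverP _ beta_wo) Kcov.
  by apply: Osub; exists K; rewrite OE.
move: Ocov; rewrite OE zero_at_coverP// order_type_ltP//.
move=> /contrapT[h [Hh h_lt]].
have /choice[f fH] : forall e, exists d, H d (h e).
  by move=> e; have [d _ Hde] := Hh e; exists d.
exists f => K /Hsmall; apply: (order_type_lt_homo _ _ h) => // e Kfe.
by exists (f e).
Qed.

Theorem theorem5p7 (da db : Order.disp_t)
    (alpha : orderType da) (beta : orderType db)
    (alpha_wo : well_ordered alpha) (beta_wo : well_ordered beta)
    (alpha_neq0 : [set: alpha] !=set0) (beta_neq0 : [set: beta] !=set0) :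
  let a := ~ ord_compact alpha alpha (tauU beta) in
  let b := exists f : beta -> alpha,
    forall K : set alpha,
      order_type_lt alpha K -> order_type_lt beta (f @^-1` K) in
  let c := forall (X : Type) (tau : set (set X)),
    [set: X] !=set0 -> tau !=set0 ->
    union_closed tau -> ord_compact alpha alpha tau ->
    ord_compact beta beta tau in
  (a <-> b) /\ (b <-> c).
Proof.
move=> a b c.
have ab : a -> b by exact: small_preimages_of_not_compact.
have bc : b -> c.
  by move=> [f f_small] X tau _ _; exact: ord_compact_transfer f_small.
have ca : c -> a.
  (* (c) applied to the space of functions with small support itself. *)
  move=> hc /hc h; apply: (tauU_not_compact beta beta_wo); apply: h.
  - have s0 : small_support beta (fun=> false).
      by apply: order_type_lt_sub (order_type_lt_set0 beta_wo beta_wo _).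
    by exists (SigSub (mem_set s0)).
  - by exists (\bigcup_(e in set0) zero_at e); exists set0.
  - exact: tauU_union_closed.
by do 2!split=> //; [move=> /bc/ca | move=> /ca/ab].
Qed.
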